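(* Let $G$ be a graph on $n$ vertices such that $\mathrm{mr}_+(G)=2$ and $G$ is not of the form $\left((K_{1,0}\cup K_{p,q})\vee K_r\right)^c$ (with $p,q$ positive integers and $r\geq 0$ an integer). Then $\mathrm{Mm}(G)=\left\lfloor \frac{n}{2}\right\rfloor$.
   Context: Graphs are finite, simple and undirected. For a graph $G$ with vertex set $\{1,\ldots,n\}$, $S(G)$ is the set of all real symmetric $n\times n$ matrices $A=(a_{ij})$ such that, for $i\ne j$, $a_{ij}\neq 0$ if and only if $\{i,j\}$ is an edge of $G$; there is no restriction on the diagonal entries. $\mathrm{Mm}(A)$ is the minimal multiplicity among the eigenvalues of $A$, and $\mathrm{Mm}(G)=\max\{\mathrm{Mm}(A): A\in S(G)\}$. $\mathrm{mr}_+(G)$ is the minimum rank among all positive semidefinite matrices in $S(G)$. $K_r$ is the complete graph on $r$ vertices; $K_{p,q}$ is the complete bipartite graph on disjoint sets of cardinality $p$ and $q$; $K_{1,0}$ is a single isolated vertex. $\cup$ denotes disjoint union; the join $G\vee H$ is $G\cup H$ together with all possible edges joining vertices of $G$ to vertices of $H$; $G^c$ is the complement of $G$. *)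

(* Defs.v *)
(* MathComp, with the real numbers of MathComp-Analysis. *)
From mathcomp Require Import all_boot all_order all_algebra.
From mathcomp Require Import reals.

Set Implicit Arguments.
Unset Strict Implicit.
Unset Printing Implicit Defensive.

Import Order.TTheory GRing.Theory Num.Theory.
Local Open Scope ring_scope.

Record sgraph (T : finType) := SGraph {
  adj :> rel T;
  adj_sym : symmetric adj;
  adj_irr : irreflexive adj
}.

Definition graph_iso (T U : finType) (G : sgraph T) (H : sgraph U) : Prop :=
  exists f : T -> U, bijective f /\ forall x y, H (f x) (f y) = G x y.

Section Constructions.
Variables T U : finType.

Definition compl_rel (G : rel T) : rel T := fun x y => (x != y) && ~~ G x y.

Lemma compl_sym (G : sgraph T) : symmetric (compl_rel G).
Proof. by move=> x y; rewrite /compl_rel eq_sym adj_sym. Qed.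

Lemma compl_irr (G : sgraph T) : irreflexive (compl_rel G).
Proof. by move=> x; rewrite /compl_rel eqxx. Qed.

Definition compl (G : sgraph T) : sgraph T := SGraph (compl_sym G) (compl_irr G).

(* [b] says whether the two sides are completely joined or not at all. *)
Definition sum_rel (b : bool) (G : rel T) (H : rel U) : rel (T + U) :=
  fun x y => match x, y with
    | inl t, inl t' => G t t'
    | inr u, inr u' => H u u'
    | _, _ => b
  end.

Lemma sum_sym b (G : sgraph T) (H : sgraph U) : symmetric (sum_rel b G H).
Proof. by move=> [x|x] [y|y] //=; apply: adj_sym. Qed.

Lemma sum_irr b (G : sgraph T) (H : sgraph U) : irreflexive (sum_rel b G H).
Proof. by move=> [x|x] /=; apply: adj_irr. Qed.

Definition disj_union (G : sgraph T) (H : sgraph U) : sgraph (T + U)%type :=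
  SGraph (sum_sym false G H) (sum_irr false G H).

Definition join (G : sgraph T) (H : sgraph U) : sgraph (T + U)%type :=
  SGraph (sum_sym true G H) (sum_irr true G H).

Lemma empty_sym : symmetric (fun _ _ : T => false).
Proof. by []. Qed.

Lemma empty_irr : irreflexive (fun _ _ : T => false).
Proof. by []. Qed.

Definition edgeless : sgraph T := SGraph empty_sym empty_irr.

End Constructions.

Definition complete (r : nat) : sgraph 'I_r := compl (edgeless 'I_r).

Definition complete_bipartite (p q : nat) : sgraph ('I_p + 'I_q)%type :=
  join (edgeless 'I_p) (edgeless 'I_q).

(* The extremal parameters are relations "the minimum (maximum) exists and
   equals m", so that no default value is needed when it does not exist. *)
Definition is_minimum (P : nat -> Prop) (m : nat) : Prop :=
  P m /\ forall k, P k -> (m <= k)%N.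

Definition is_maximum (P : nat -> Prop) (m : nat) : Prop :=
  P m /\ forall k, P k -> (k <= m)%N.

Section SpectralInvariants.
Variables (R : realType) (n : nat).

Definition in_S (G : sgraph 'I_n) (A : 'M[R]_n) : Prop :=
  A^T = A /\ forall i j : 'I_n, i != j -> (A i j != 0) = G i j.

Definition is_Mm_mx (A : 'M[R]_n) : nat -> Prop :=
  is_minimum (fun m => exists2 a : R, eigenvalue A a & \rank (eigenspace A a) = m).

Definition is_Mm (G : sgraph 'I_n) : nat -> Prop :=
  is_maximum (fun m => exists2 A : 'M[R]_n, in_S G A & is_Mm_mx A m).

Definition psd (A : 'M[R]_n) : Prop :=
  A^T = A /\ forall x : 'cV[R]_n, 0 <= (x^T *m A *m x) 0 0.

Definition is_mrplus (G : sgraph 'I_n) : nat -> Prop :=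
  is_minimum (fun m => exists2 A : 'M[R]_n, in_S G A /\ psd A & \rank A = m).

End SpectralInvariants.
Arguments is_Mm R {n} G m.
Arguments is_mrplus R {n} G m.

(* Main.v *)
Require Import Defs.
From mathcomp Require Import all_boot all_order all_algebra.
From mathcomp Require Import reals.
From mathcomp Require Import complex ring lra zify.

(** Write N[x] for the closed neighbourhood of x; call x and y twins when
    N[x] = N[y].

    Upper bound.  A matrix in S(G) is not scalar, since G has an edge; being
    symmetric it then has two distinct real eigenvalues.  Two eigenspaces of
    dimension at least m meet trivially, so 2m <= n.

    Lower bound.  It is enough to find an orthogonal projection P in S(G) of
    rank floor(n/2), as its only eigenvalues 1 and 0 have multiplicities
    floor(n/2) and ceil(n/2) (projection_Mm_mx).  Such a projection is grown
    from a projection on a small induced subgraph.  A new vertex y enters either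
    as an isolated vertex, by adding 0 or 1 at the diagonal entry (y, y), or as
    a twin of an old non-isolated vertex x, by doing the same and then reflecting
    the plane of x and y (projection_on_twin).  Each time the rank may be kept
    or raised by one, so a projection of rank k on 2k or 2k + 1 vertices grows
    to one of rank floor(n/2) on all vertices (projection_on_extend).

    It remains to find the small subgraph.  A positive semidefinite matrix of
    rank 2 is a Gram matrix of vectors in the plane, where two nonzero vectors
    orthogonal to a third one are parallel.  Hence two non-isolated vertices
    with a common non-neighbour are twins (common_nonneighbor_twin), and one
    representative of each twin class gives a graph in which every vertex has at
    most one non-neighbour, with at most one vertex u joined to all others: l
    pairs of non-adjacent vertices, plus possibly u.
    - If l >= 2, an explicit tight frame of R^l has this non-orthogonality
      pattern (cocktail_party_projection).
    - If l = 1 without u, the graph is a union of two cliques with at least two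
      vertices each, plus isolated vertices, and two disjoint edges form an
      induced subgraph (two_edges_projection).
    - If l = 1 with u, and u has a twin, there is an induced K_4 minus an edge
      (diamond_projection).
    - If l = 1 with u, and u has no twin, the graph is two cliques sharing the
      neighbour u, plus isolated vertices: the excluded family
      (excluded_shape_iso).
    Finally l = 0 is impossible, for a clique plus isolated vertices carries a
    positive semidefinite matrix of rank at most 1 (mrplus2_nonadjacent). *)

Set Implicit Arguments.
Unset Strict Implicit.
Unset Printing Implicit Defensive.

Import Order.TTheory GRing.Theory Num.Theory.
Local Open Scope ring_scope.

(** * Eigenvalues of symmetric matrices and projections *)

(** Over the complex numbers a Hermitian matrix is unitarily similar to a real
    diagonal matrix, which is nonzero when the matrix is; a real root of the
    complexified characteristic polynomial is a root of the original one. *)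
Lemma symmetric_eigenvalue_neq0 (R : realType) n (B : 'M[R]_n) :
  B^T = B -> B != 0 -> exists2 c : R, c != 0 & eigenvalue B c.
Proof.
move=> symB nzB.
pose f : {rmorphism R -> R[i]} := real_complex R.
pose C := map_mx f B.
have hC : C \is hermitianmx _ false Num.conj.
  apply/is_hermitianmxP; rewrite expr0 scale1r.
  apply/matrixP=> i j; rewrite !mxE.
  by rewrite -[in LHS]symB mxE; apply/esym/(conjc_real (B j i)).
have /orthomx_spectralP eqC := hermitian_normalmx hC.
have /mxOverP realD := hermitian_spectral_diag_real hC.
have unitP := spectral_unit C.
set P := spectralmx C in eqC unitP; set D := spectral_diag C in eqC realD.
have : D != 0.
  apply/eqP=> D0; move: eqC; rewrite D0 linear0 mulmx0 mul0mx => C0.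
  case/negP: nzB; apply/eqP/matrixP=> i j; apply: (fmorph_inj f).
  by move/matrixP: C0 => /(_ i j); rewrite !mxE => ->; rewrite rmorph0.
case/rV0Pn=> i nzDi.
have eigD : eigenvalue C (D 0 i).
  apply/eigenvalueP; exists (row i P).
    rewrite {1}eqC !mulmxA -row_mul mulmxV // row1 -rowE row_diag_mx.
    by rewrite -scalemxAl -rowE.
  rewrite rowE; apply/eqP=> /(congr1 (mulmx^~ (invmx P))).
  rewrite mulmxK // mul0mx => /matrixP/(_ 0 i)/eqP.
  by rewrite !mxE !eqxx oner_eq0.
have /complex_realP[c Dc] := realD 0 i.
exists c; first by apply: contra_neq nzDi => c0; rewrite Dc c0.
by move: eigD; rewrite !eigenvalue_root_char -map_char_poly Dc (fmorph_root f).
Qed.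

Lemma add_rank_eigenspace_leq (F : fieldType) n (A : 'M[F]_n) (a b : F) :
  a != b -> (\rank (eigenspace A a) + \rank (eigenspace A b) <= n)%N.
Proof.
move=> neq_ab; rewrite -mxrank_disjoint_sum ?rank_leq_col //.
apply/eqP/rowV0P=> v; rewrite sub_capmx => /andP[/eigenspaceP va /eigenspaceP vb].
move/eqP: vb; rewrite va -subr_eq0 -scalerBl scaler_eq0 subr_eq0 (negPf neq_ab).
by move/eqP.
Qed.

(** For a full-rank factorization A = C B, idempotence cancels to B C = 1, and
    tr (C B) = tr (B C).  This lets ranks be tracked through traces below. *)
Lemma idempotent_rank_trace (F : fieldType) n (A : 'M[F]_n) :
  A *m A = A -> \tr A = (\rank A)%:R.
Proof.
move=> idA; have := mulmx_base A.
move: (row_base_free A) (col_base_full A).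
move: (row_base A) (col_base A) => B C freeB /row_fullP[L LC] defA.
rewrite -[in LHS]defA mxtrace_mulC.
suff -> : B *m C = 1%:M by rewrite mxtrace1.
apply: (row_free_inj freeB); rewrite mul1mx.
have : C *m B *m (C *m B) = C *m B by rewrite defA.
move/(congr1 (mulmx L)).
by rewrite !mulmxA LC !mul1mx.
Qed.

Lemma Mm_upper_bound (R : realType) n (G : sgraph 'I_n) (A : 'M[R]_n) m x y :
  G x y -> in_S G A -> is_Mm_mx A m -> (m <= n./2)%N.
Proof.
move=> Gxy [symA GA] [[a eig_a <-] minA].
have neq_xy : x != y by apply: contraTneq Gxy => ->; rewrite adj_irr.
have nzB : A - a%:M != 0.
  apply: contraTneq Gxy => /matrixP/(_ x y); rewrite !mxE (negPf neq_xy) subr0.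
  by rewrite -GA // => ->; rewrite eqxx.
have symB : (A - a%:M)^T = A - a%:M by rewrite linearB /= tr_scalar_mx symA.
have [c nzc /eigenvalueP[v vB nzv]] := symmetric_eigenvalue_neq0 symB nzB.
have neq_ac : a != a + c by rewrite -subr_eq0 opprD addNKr oppr_eq0.
have eig_ac : eigenvalue A (a + c).
  apply/eigenvalueP; exists v => //; rewrite scalerDl -vB mulmxBr mul_mx_scalar.
  by rewrite addrC subrK.
have le_ac : (\rank (eigenspace A a) <= \rank (eigenspace A (a + c)))%N.
  by apply: minA; exists (a + c).
have := add_rank_eigenspace_leq A neq_ac.
by move: le_ac; lia.
Qed.

(** The eigenvalues of P are 1 and 0, with eigenspaces of dimensions k and
    n - k. *)
Lemma projection_Mm_mx (R : realType) n (P : 'M[R]_n) k :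
    P *m P = P -> \tr P = k%:R -> (0 < k <= n - k)%N -> is_Mm_mx P k.
Proof.
move=> idP trP /andP[k_gt0 le_k].
have rkP : \rank P = k.
  by apply/eqP; rewrite -(eqr_nat R) -idempotent_rank_trace // trP.
have idQ : (1%:M - P) *m (1%:M - P) = 1%:M - P.
  by rewrite mulmxBr mulmx1 mulmxBl mul1mx idP subrr subr0.
have rkQ : \rank (1%:M - P) = (n - k)%N.
  apply/eqP; rewrite -(eqr_nat R) -idempotent_rank_trace //.
  by rewrite linearB /= mxtrace1 trP natrB //; lia.
have rk1 : \rank (eigenspace P 1) = k.
  by rewrite mxrank_ker -opprB eqmx_opp rkQ; lia.
have rk0 : \rank (eigenspace P 0) = (n - k)%N.
  by rewrite mxrank_ker raddf0 subr0 rkP.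
split; first by exists 1; rewrite // /eigenvalue -mxrank_eq0 rk1 -lt0n.
move=> _ [a /eigenvalueP[v vP nzv] <-].
have /eqP : a *: v = a *: (a *: v).
  by rewrite -{1}vP -{1}idP mulmxA vP -scalemxAl vP.
rewrite -subr_eq0 scalerA -scalerBl scaler_eq0 (negPf nzv) orbF.
rewrite -{1}[a]mulr1 -mulrBr mulf_eq0 subr_eq0 => /orP[/eqP->|/eqP<-].
  by rewrite rk0.
by rewrite rk1.
Qed.

(** * Growing a projection by isolated vertices and twins *)

Definition closed_nbhd (T : finType) (G : sgraph T) (x : T) : {set T} :=
  [set y | (y == x) || G x y].

(** Orthogonal projections living on S that realize the graph induced on S.
    Matrices keep size n and vanish outside S, so that S can grow vertex by
    vertex; k is the rank, recorded as a trace. *)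
Definition projection_on (R : realType) n (G : sgraph 'I_n) (S : {set 'I_n})
    (k : nat) (F : 'M[R]_n) : Prop :=
  [/\ F^T = F, F *m F = F, \tr F = k%:R,
      forall i j, i \notin S -> F i j = 0
    & {in S &, forall i j, i != j -> (F i j != 0) = G i j}].

Lemma projection_on_sym (R : realType) n (G : sgraph 'I_n) S k (F : 'M[R]_n) :
  projection_on G S k F -> forall i j, F i j = F j i.
Proof. by case=> symF _ _ _ _ i j; rewrite -[in LHS]symF mxE. Qed.

Lemma projection_on_outr (R : realType) n (G : sgraph 'I_n) S k (F : 'M[R]_n) :
  projection_on G S k F -> forall i j, j \notin S -> F i j = 0.
Proof.
move=> pF i j Sj; rewrite (projection_on_sym pF).
by case: pF => _ _ _ F0 _; apply: F0.
Qed.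

(** The diagonal entry of a projection is the squared norm of its row, so
    F x x - (F x x)^2 >= (F x z)^2 > 0 as soon as x has a neighbour z: such a
    diagonal entry is neither 0 nor 1. *)
Lemma projection_on_diag_neq (R : realType) n (G : sgraph 'I_n) S k
    (F : 'M[R]_n) x z (e : bool) :
  projection_on G S k F -> x \in S -> z \in S -> G x z -> F x x - e%:R != 0.
Proof.
move=> pF Sx Sz Gxz; have symF := projection_on_sym pF.
have [_ idF _ _ GF] := pF.
have neq_zx : z != x by apply: contraTneq Gxz => ->; rewrite adj_irr.
have nzF : F x z != 0 by rewrite GF // eq_sym.
have := congr1 (fun M : 'M[R]_n => M x x) idF.
rewrite mxE (bigD1 x) //= (bigD1 z) //= (symF z x).
set s := \sum_(i | _) _ => eqF.
have s_ge0 : 0 <= s by apply: sumr_ge0 => i _; rewrite (symF i x) -expr2 sqr_ge0.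
have z_gt0 : 0 < F x z * F x z by rewrite -expr2 exprn_even_gt0.
move: (F x x) (F x z * F x z) eqF z_gt0 => d f eqF f_gt0.
by clear -eqF f_gt0 s_ge0; apply/eqP; case: e => /= De; nra.
Qed.

Lemma add_delta_idempotent (R : realType) n (F : 'M[R]_n) y k (e : bool) :
    F^T = F -> F *m F = F -> \tr F = k%:R -> (forall j, F y j = 0) ->
  let E := F + e%:R *: delta_mx y y in
  [/\ E^T = E, E *m E = E & \tr E = (k + e)%:R].
Proof.
move=> symF idF trF F0.
have yF0 : delta_mx y y *m F = 0.
  apply/matrixP=> i j; rewrite !mxE big1 // => l _; rewrite mxE.
  by have [->|_] := eqVneq l y; rewrite ?F0 ?mulr0 // andbF mul0r.
have Fy0 : F *m delta_mx y y = 0.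
  by rewrite -[F]symF -trmx_delta -trmx_mul yF0 trmx0.
split.
- by rewrite linearD linearZ /= trmx_delta symF.
- rewrite mulmxDl !mulmxDr -!scalemxAl -!scalemxAr idF Fy0 yF0 mul_delta_mx.
  by rewrite !scaler0 addr0 add0r scalerA -natrM mulnb andbb.
- rewrite mxtraceD mxtraceZ trF natrD /mxtrace (bigD1 y) //= mxE !eqxx.
  by rewrite big1 ?addr0 ?mulr1 // => i /negPf iy; rewrite mxE iy.
Qed.

Lemma projection_on_isolated (R : realType) n (G : sgraph 'I_n) S k
    (F : 'M[R]_n) y (e : bool) :
  projection_on G S k F -> y \notin S -> {in S, forall z, ~~ G y z} ->
  projection_on G (y |: S) (k + e) (F + e%:R *: delta_mx y y).
Proof.
move=> pF Sy isoy; have F0r := projection_on_outr pF.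
have [symF idF trF F0 GF] := pF.
have [symE idE trE] := add_delta_idempotent e symF idF trF (F0 y ^~ Sy).
split=> //.
- move=> i j; rewrite in_setU1 negb_or => /andP[iy Si].
  by rewrite !mxE F0 // (negPf iy) mulr0 addr0.
- move=> i j; rewrite !in_setU1 !mxE.
  have [->|iy] := eqVneq i y; have [->|jy] //= := eqVneq j y.
  + by move=> _ Sj _; rewrite F0 // mulr0 addr0 eqxx (negPf (isoy j Sj)).
  + by move=> Si _ _; rewrite F0r // mulr0 addr0 eqxx adj_sym (negPf (isoy i Si)).
  + by move=> Si Sj neq_ij; rewrite mulr0 addr0 GF.
Qed.

(** Any reflection of the plane spanned by e_x and e_y whose 2 x 2 matrix has no
    zero entry would serve; the Pythagorean triple (3, 4, 5) keeps it rational. *)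
Definition plane_reflection (R : realType) n (x y : 'I_n) : 'M[R]_n :=
  \matrix_(i, j)
    if j == x then (i == x)%:R * (3 / 5) + (i == y)%:R * (4 / 5)
    else if j == y then (i == x)%:R * (4 / 5) - (i == y)%:R * (3 / 5)
    else (i == j)%:R.

Lemma mulmx_plane_reflection (R : realType) n (x y : 'I_n) (A : 'M[R]_n) i j :
  (A *m plane_reflection R x y) i j =
  if j == x then A i x * (3 / 5) + A i y * (4 / 5)
  else if j == y then A i x * (4 / 5) - A i y * (3 / 5)
  else A i j.
Proof.
have pick (l : 'I_n) (c : R) : \sum_(m < n) A i m * ((m == l)%:R * c) = A i l * c.
  rewrite (bigD1 l) //= eqxx mul1r big1 ?addr0 // => m /negPf->.
  by rewrite mul0r mulr0.
rewrite mxE; case: (boolP (j == x)) => jx.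
  by under eq_bigr do rewrite mxE jx mulrDr; rewrite big_split /= !pick.
case: (boolP (j == y)) => jy.
  under eq_bigr do rewrite mxE (negPf jx) jy mulrBr.
  by rewrite sumrB /= !pick.
under eq_bigr do rewrite mxE (negPf jx) (negPf jy) -[_%:R]mulr1.
by rewrite pick mulr1.
Qed.

Lemma tr_plane_reflection (R : realType) n (x y : 'I_n) : x != y ->
  (plane_reflection R x y)^T = plane_reflection R x y.
Proof.
move=> /eqP neq_xy; apply/matrixP=> i j; rewrite !mxE.
by repeat case: eqP => ?; try congruence; rewrite /=; field.
Qed.

Lemma plane_reflectionK (R : realType) n (x y : 'I_n) : x != y ->
  plane_reflection R x y *m plane_reflection R x y = 1%:M.
Proof.
move=> /eqP neq_xy; apply/matrixP=> i j; rewrite mulmx_plane_reflection !mxE.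
by repeat case: eqP => ?; try congruence; rewrite /=; field.
Qed.

(** Put e at the entry (y, y) and conjugate by the reflection in the plane of x
    and y.  Rows x and y become nonzero multiples of the old row x away from x
    and y, as wanted for twins, and the new entry (x, y) is
    12/25 (F x x - e), which is nonzero because x has a neighbour. *)
Lemma projection_on_twin (R : realType) n (G : sgraph 'I_n) S k
    (F : 'M[R]_n) x y z (e : bool) :
    projection_on G S k F -> y \notin S -> x \in S ->
    closed_nbhd G x = closed_nbhd G y -> z \in S -> G x z ->
  exists F' : 'M[R]_n, projection_on G (y |: S) (k + e) F'.
Proof.
move=> pF Sy Sx twin Sz Gxz; have F0r := projection_on_outr pF.
have dF := projection_on_diag_neq e pF Sx Sz Gxz.
have [symF idF trF F0 GF] := pF.
have neq_xy : x != y by apply: contraNneq Sy => <-.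
have Gtw w : w != x -> w != y -> G y w = G x w.
  by move=> wx wy; move/setP/(_ w): twin; rewrite !inE (negPf wx) (negPf wy).
have Gxy : G x y.
  by move/setP/(_ y): twin; rewrite !inE eqxx eq_sym (negPf neq_xy).
pose H := plane_reflection R x y.
have HT : H^T = H by apply: tr_plane_reflection.
have HH : H *m H = 1%:M by apply: plane_reflectionK.
pose E := F + e%:R *: delta_mx y y.
have [symE idE trE] := add_delta_idempotent e symF idF trF (F0 y ^~ Sy).
rewrite -/E in symE idE trE.
have EE i j : E i j = F i j + e%:R * ((i == y) && (j == y))%:R by rewrite !mxE.
have HEE i j : (H *m E) i j = (E *m H) j i.
  by rewrite -[in LHS]HT -[in LHS]symE -trmx_mul mxE.
have F0y j : F y j = 0 by apply: F0.
have Fy0 j : F j y = 0 by apply: F0r.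
have symM : (H *m E *m H)^T = H *m E *m H by rewrite !trmx_mul HT symE mulmxA.
exists (H *m E *m H); split=> //.
- by rewrite -!mulmxA (mulmxA H H) HH mul1mx (mulmxA E E) idE.
- by rewrite mxtrace_mulC mulmxA HH mul1mx.
- move=> i j; rewrite in_setU1 negb_or => /andP[iy Si].
  have ix : i != x by apply: contraNneq Si => ->.
  rewrite mulmx_plane_reflection !HEE !mulmx_plane_reflection.
  rewrite (negPf ix) (negPf iy) !EE (negPf iy) !(F0r _ i) //.
  rewrite !andbF !mulr0 !addr0.
  by repeat case: ifP => _; rewrite ?mul0r ?addr0 ?subr0.
have entry i j : (H *m E *m H) i j = (H *m E *m H) j i.
  by rewrite -[in LHS]symM mxE.
have xy_entry : (H *m E *m H) x y != 0.
  rewrite mulmx_plane_reflection !HEE !mulmx_plane_reflection !EE.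
  rewrite (eq_sym y x) !eqxx (negPf neq_xy) !F0y !Fy0.
  rewrite /= (_ : _ - _ = 12 / 25 * (F x x - e%:R)); last by field.
  by rewrite mulf_neq0 // mulf_neq0 ?invr_eq0 ?pnatr_eq0.
have x_entry i : i != x -> i != y -> (H *m E *m H) i x = 3 / 5 * F i x.
  move=> ix iy.
  rewrite mulmx_plane_reflection !HEE !mulmx_plane_reflection !EE.
  rewrite !eqxx (negPf ix) (negPf iy) F0y !andbF -[F x i](projection_on_sym pF).
  by rewrite !mulr0 !addr0 mul0r addr0 mulrC.
have y_entry i : i != x -> i != y -> (H *m E *m H) i y = 4 / 5 * F i x.
  move=> ix iy.
  rewrite mulmx_plane_reflection !HEE !mulmx_plane_reflection !EE.
  rewrite (eq_sym y) (negPf neq_xy) !eqxx (negPf ix) (negPf iy) F0y !andbF.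
  rewrite (projection_on_sym pF x i).
  by rewrite !mulr0 !addr0 mul0r subr0 mulrC.
have z_entry i j : i != x -> i != y -> j != x -> j != y ->
    (H *m E *m H) i j = F i j.
  move=> ix iy jx jy.
  rewrite mulmx_plane_reflection !HEE !mulmx_plane_reflection !EE.
  rewrite (negPf ix) (negPf iy) (negPf jx) (negPf jy) (projection_on_sym pF j i).
  by rewrite mulr0 addr0.
have scaled (c : R) (i : 'I_n) : c != 0 -> i \in S -> i != x ->
    (c * F i x != 0) = G i x.
  by move=> nzc Si ix; rewrite mulf_eq0 (negPf nzc) GF.
have nz35 : 3 / 5 != 0 :> R by rewrite mulf_neq0 ?invr_eq0 ?pnatr_eq0.
have nz45 : 4 / 5 != 0 :> R by rewrite mulf_neq0 ?invr_eq0 ?pnatr_eq0.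
move=> i j; rewrite !in_setU1.
have [->|iy] := eqVneq i y; have [->|jy] //= := eqVneq j y.
- move=> _ Sj _; rewrite entry.
  have [->|jx] := eqVneq j x; first by rewrite xy_entry adj_sym Gxy.
  by rewrite y_entry // scaled // Gtw // adj_sym.
- move=> Si _ _.
  have [->|ix] := eqVneq i x; first by rewrite xy_entry Gxy.
  by rewrite y_entry // scaled // adj_sym [RHS]adj_sym Gtw.
move=> Si Sj neq_ij.
have [eq_i|ix] := eqVneq i x; have [eq_j|jx] := eqVneq j x.
- by rewrite eq_i eq_j eqxx in neq_ij.
- by rewrite eq_i entry x_entry // scaled // adj_sym.
- by rewrite eq_j x_entry // scaled.
- by rewrite z_entry // GF.
Qed.

(** Each of the n - #|S0| insertions keeps or raises the rank, so every rank in
    between is reached; twins are required to be twins of vertices in S0, so the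
    order of insertion does not matter. *)
Lemma projection_on_extend (R : realType) n (G : sgraph 'I_n)
    (S0 : {set 'I_n}) (k0 : nat) (F0 : 'M[R]_n) :
    projection_on G S0 k0 F0 ->
    (forall y, y \notin S0 -> (forall z, ~~ G y z) \/
       exists x z, [/\ x \in S0, z \in S0, G x z
                     & closed_nbhd G x = closed_nbhd G y]) ->
  forall j, (j <= n - #|S0|)%N ->
  exists F : 'M[R]_n, projection_on G [set: 'I_n] (k0 + j) F.
Proof.
move=> pF0 extS0.
suff ext (S : {set 'I_n}) : S0 \subset S -> forall j, (j <= #|S| - #|S0|)%N ->
    exists F : 'M[R]_n, projection_on G S (k0 + j) F.
  by move=> j lejn; apply: ext; rewrite ?subsetT // cardsT card_ord.
have [m] := ubnP #|S|; elim: m S => // m IHm S leSm sub j lejS.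
have [subS|/subsetPn[y Sy S0y]] := boolP (S \subset S0).
  have eqS0 : S = S0 by apply/eqP; rewrite eqEsubset sub subS.
  exists F0; move: lejS; rewrite eqS0 subnn leqn0 => /eqP->.
  by rewrite addn0.
pose S' := S :\ y.
have defS : S = y |: S' by rewrite setD1K.
have S'y : y \notin S' by rewrite !inE eqxx.
have subS' : S0 \subset S' by rewrite subsetD1 sub.
have cardS : #|S| = #|S'|.+1 by rewrite defS cardsU1 S'y.
have le_card := subset_leq_card subS'; rewrite cardS in lejS.
(* e tells whether the insertion of y has to raise the rank *)
have [e [lej lejS']] :
    exists e : bool, (e <= j)%N /\ (j - e <= #|S'| - #|S0|)%N.
  move: lejS le_card; move: #|S'| #|S0| => a b lejS le_card.
  by exists (a - b < j)%N; case: ltnP => /=; lia.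
have [F pF] : exists F : 'M[R]_n, projection_on G S' (k0 + (j - e)) F.
  by apply: IHm => //; rewrite -ltnS -cardS.
have -> : (k0 + j = k0 + (j - e) + e)%N by rewrite -addnA subnK.
rewrite defS; case: (extS0 y S0y) => [isoy|[x [z [S0x S0z Gxz twin]]]].
  by eexists; apply: (projection_on_isolated e pF S'y) => z _; apply: isoy.
apply: (projection_on_twin e pF S'y _ twin _ Gxz).
  exact: (subsetP subS').
exact: (subsetP subS').
Qed.

(** * Tight frames for the small graphs *)

(** The columns (W i u)_i form a tight frame of R^k: W W^T = N makes W^T W / N
    idempotent of trace k, and its entries are the inner products of the frame
    vectors divided by N.  The map f places the abstract index set U among the
    vertices. *)
Lemma frame_projection (R : realType) n (G : sgraph 'I_n) (U : finType) k
    (W : 'I_k -> U -> R) (N : R) (f : U -> 'I_n) :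
    injective f -> N != 0 ->
    (forall i j, \sum_u W i u * W j u = N * (i == j)%:R) ->
    (forall u v, u != v -> (\sum_i W i u * W i v != 0) = G (f u) (f v)) ->
  exists F : 'M[R]_n, projection_on G (f @: [set: U]) k F.
Proof.
move=> injf nzN orthW GW.
pose M : 'M[R]_(k, n) := \matrix_(i, x) \sum_(u | f u == x) W i u.
have Mf i u : M i (f u) = W i u.
  rewrite mxE (bigD1 u) //= big1 ?addr0 // => v /andP[/eqP/injf->].
  by rewrite eqxx.
have M0 i x : x \notin f @: [set: U] -> M i x = 0.
  move=> fx; rewrite mxE big1 // => u /eqP Dx.
  by rewrite -Dx imset_f in fx.
have MMT : M *m M^T = N%:M.
  apply/matrixP=> i j; rewrite !mxE -mulr_natr -orthW.
  rewrite (bigID [in f @: [set: U]]) /= addrC big1 ?add0r => [|x fx].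
    rewrite big_imset /=; last by move=> u v _ _ /injf.
    by apply: eq_big => [u|u _]; rewrite ?inE // !mxE -!Mf !mxE.
  by rewrite M0 // mul0r.
exists (N^-1 *: (M^T *m M)); split.
- by rewrite linearZ /= trmx_mul trmxK.
- rewrite -scalemxAl -scalemxAr -mulmxA (mulmxA M) MMT mul_scalar_mx.
  by rewrite -scalemxAr scalerA mulVf // scale1r.
- by rewrite mxtraceZ mxtrace_mulC MMT mxtrace_scalar -[N *+ k]mulr_natr mulKf.
- move=> x y fx; rewrite !mxE big1 ?mulr0 // => i _.
  by rewrite mxE M0 // mul0r.
move=> _ _ /imsetP[u _ ->] /imsetP[v _ ->] neq_uv.
rewrite -GW; last by apply: contraNneq neq_uv => ->.
rewrite !mxE mulf_eq0 invr_eq0 (negPf nzN) /=.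
by under eq_bigr do rewrite mxE !Mf.
Qed.

(** Non-adjacency in the cocktail party graph with h extra vertices: the two
    summands 'I_l hold the two ends of the l non-adjacent pairs, and 'I_h the
    vertices joined to all others. *)
Definition opposite l h (u v : 'I_l + 'I_l + 'I_h) : bool :=
  match u, v with
  | inl (inl i), inl (inr j) | inl (inr i), inl (inl j) => i == j
  | _, _ => false
  end.

Lemma sum_delta_affine (R : comRingType) l (i j : 'I_l) (a b c d : R) :
  \sum_(m < l) (a * (m == i)%:R + b) * (c * (m == j)%:R + d) =
  a * c * (i == j)%:R + a * d + b * c + l%:R * b * d.
Proof.
have pick (m0 : 'I_l) (g : 'I_l -> R) : \sum_(m < l) g m * (m == m0)%:R = g m0.
  by rewrite (bigD1 m0) //= eqxx mulr1 big1 ?addr0 // => m /negPf->; rewrite mulr0.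
transitivity (\sum_(m < l) (a * (c * (m == j)%:R + d) * (m == i)%:R
              + (b * c * (m == j)%:R + b * d))).
  by apply: eq_bigr => m _; ring.
rewrite !big_split /= !pick sumr_const card_ord -mulr_natl.
ring.
Qed.

(** With e_j the standard basis of R^l and 1 the all-ones vector, the frame is
    e_j + 1 and -(l + 1) kap e_j + 2 kap 1 for the two ends of the j-th pair, and 1
    for the vertex joined to all others.  The coefficients make opposite ends
    orthogonal, and all other inner products nonzero: l + 2, (l + 1) kap,
    -4 kap^2, l + 1 and (l - 1) kap.  The scale kap is fixed by the tightness
    condition 4 kap^2 = l + 2 + h.  The product (l - 1) kap is where l > 1 matters. *)
Lemma cocktail_party_projection (R : realType) n (G : sgraph 'I_n) l h
    (f : 'I_l + 'I_l + 'I_h -> 'I_n) :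
    (1 < l)%N -> (h <= 1)%N -> injective f ->
    (forall u v, u != v -> G (f u) (f v) = ~~ opposite u v) ->
  exists F : 'M[R]_n, projection_on G (f @: [set: 'I_l + 'I_l + 'I_h]) l F.
Proof.
move=> l_gt1 h_le1 injf Gf.
have [kap nzkap kap2] : exists2 kap : R, kap != 0 &
    4 * kap * kap = l%:R + 2 + h%:R.
  have := sqr_sqrtr (ler0n R (l + 2 + h)).
  set s := Num.sqrt _ => sqr_s; exists (s / 2); last first.
    by move: sqr_s; rewrite !natrD => <-; field.
  have : s ^+ 2 != 0 by rewrite sqr_s pnatr_eq0 addn2.
  by rewrite expf_eq0 /= => nzs; rewrite mulf_neq0 // invr_eq0 pnatr_eq0.
have l_gt1R : 1 < l%:R :> R by rewrite ltr1n.
pose W (i : 'I_l) (u : 'I_l + 'I_l + 'I_h) : R :=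
  match u with
  | inl (inl j) => 1 * (i == j)%:R + 1
  | inl (inr j) => - ((l%:R + 1) * kap) * (i == j)%:R + 2 * kap
  | inr _ => 1
  end.
apply: (@frame_projection _ _ _ _ _ W (1 + (l%:R + 1) ^+ 2 * kap ^+ 2) _ injf).
- by rewrite lt0r_neq0 // ltr_pwDl // -exprMn sqr_ge0.
- move=> i j; rewrite !big_sumType /=.
  under eq_bigr do rewrite (eq_sym i) (eq_sym j).
  under [X in _ + X + _]eq_bigr do rewrite (eq_sym i) (eq_sym j).
  rewrite !sum_delta_affine sumr_const card_ord mulr1.
  rewrite (_ : h%:R = 4 * kap * kap - l%:R - 2); first by ring.
  by rewrite kap2; ring.
have sum_aff (j : 'I_l) (a b : R) :
    \sum_(i < l) (a * (i == j)%:R + b) * 1 = a + l%:R * b.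
  rewrite (_ : a + l%:R * b = a * 0 * (j == j)%:R + a * 1 + b * 0 + l%:R * b * 1).
    by rewrite -sum_delta_affine; apply: eq_bigr => i _; rewrite mul0r add0r.
  by rewrite eqxx; ring.
have cross i j : (\sum_m W m (inl (inl i)) * W m (inl (inr j)) != 0) = (i != j).
  rewrite sum_delta_affine.
  have [_|_] := eqVneq i j; first by apply/eqP; rewrite /=; ring.
  rewrite (_ : _ + _ = (l%:R + 1) * kap); last by rewrite /=; ring.
  by rewrite mulf_neq0 // lt0r_neq0 // ltr_pwDr.
have sumC u v : \sum_m W m u * W m v = \sum_m W m v * W m u.
  by apply: eq_bigr => m _; rewrite mulrC.
have with_h i k : \sum_m W m (inl i) * W m (inr k) != 0.
  case: i => i; rewrite sum_aff.
    by rewrite lt0r_neq0 // mulr1 ltr_wpDr // ltW // (lt_trans ltr01).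
  rewrite (_ : _ + _ = (l%:R - 1) * kap); last by ring.
  by rewrite mulf_neq0 // subr_eq0 gt_eqF.
have nz4 : 4 != 0 :> R by rewrite pnatr_eq0.
move=> u v neq_uv; rewrite Gf //.
case: u v neq_uv => [[i|i]|k] [[j|j]|k'] neq_uv; rewrite [opposite _ _]/=.
- have /negPf neq_ij : i != j by [].
  rewrite sum_delta_affine neq_ij (_ : _ + _ = l%:R + 2); last by rewrite /=; ring.
  by rewrite lt0r_neq0 // addr_gt0 // (lt_trans ltr01).
- exact: cross.
- exact: (with_h (inl i) k').
- by rewrite sumC cross eq_sym.
- have /negPf neq_ij : i != j by [].
  rewrite sum_delta_affine neq_ij (_ : _ + _ = - (4 * kap * kap)); last by rewrite /=; ring.
  by rewrite oppr_eq0 !mulf_neq0.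
- exact: (with_h (inr i) k').
- by rewrite sumC; apply: (with_h (inl j) k).
- by rewrite sumC; apply: (with_h (inr j) k).
- case/eqP: neq_uv; congr inr; apply: val_inj => /=.
  by have := ltn_ord k; have := ltn_ord k'; lia.
Qed.

Definition quad n (a b c d : 'I_n) (u : 'I_4) : 'I_n :=
  nth a [:: a; b; c; d] u.

Lemma quad_inj n (a b c d : 'I_n) : uniq [:: a; b; c; d] -> injective (quad a b c d).
Proof.
by move=> uniq_s u v /eqP; rewrite nth_uniq ?ltn_ord // => /eqP/val_inj.
Qed.

Lemma quad_imset n (a b c d : 'I_n) :
  quad a b c d @: [set: 'I_4] = [set x in [:: a; b; c; d]].
Proof.
apply/setP=> x; rewrite inE; apply/imsetP/idP => [[u _ ->]|].
  by rewrite mem_nth //; apply: ltn_ord.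
by case/(nthP a)=> i lti <-; exists (Ordinal lti).
Qed.

(** The columns (7,0), (0,3), (1,6), (2,-3) of a matrix whose two rows are orthogonal
    and have squared norm 54: only the first two columns are orthogonal. *)
Lemma diamond_projection (R : realType) n (G : sgraph 'I_n) (a b c d : 'I_n) :
    uniq [:: a; b; c; d] -> ~~ G a b ->
    [/\ G a c, G a d, G b c, G b d & G c d] ->
  exists F : 'M[R]_n, projection_on G [set x in [:: a; b; c; d]] 2 F.
Proof.
move=> uniq_s /negPf Gab [Gac Gad Gbc Gbd Gcd].
pose W (i : 'I_2) (u : 'I_4) : R :=
  nth 0 (nth [::] [:: [:: 7; 0; 1; 2]; [:: 0; 3; 6; -3]] i) u.
rewrite -quad_imset; apply: (@frame_projection _ _ _ _ _ W 54 _ (quad_inj uniq_s)).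
- by rewrite pnatr_eq0.
- move=> i j; rewrite !big_ord_recl big_ord0 /W.
  by case: i j => [[|[|//]] ?] [[|[|//]] ?] /=; ring.
move=> u v; rewrite !big_ord_recl big_ord0 /W /quad.
case: u v => [[|[|[|[|//]]]] ?] [[|[|[|[|//]]]] ?] //= _;
  rewrite ?(adj_sym G b a) ?(adj_sym G c) ?(adj_sym G d);
  rewrite ?Gab ?Gac ?Gad ?Gbc ?Gbd ?Gcd;
  by [apply/eqP; ring | apply/eqP => eq0; clear -eq0; lra].
Qed.

Lemma two_edges_projection (R : realType) n (G : sgraph 'I_n) (a b c d : 'I_n) :
    uniq [:: a; b; c; d] -> G a b -> G c d ->
    [/\ ~~ G a c, ~~ G a d, ~~ G b c & ~~ G b d] ->
  exists F : 'M[R]_n, projection_on G [set x in [:: a; b; c; d]] 2 F.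
Proof.
move=> uniq_s Gab Gcd [/negPf Gac /negPf Gad /negPf Gbc /negPf Gbd].
pose W (i : 'I_2) (u : 'I_4) : R :=
  nth 0 (nth [::] [:: [:: 1; 1; 0; 0]; [:: 0; 0; 1; 1]] i) u.
rewrite -quad_imset; apply: (@frame_projection _ _ _ _ _ W 2 _ (quad_inj uniq_s)).
- by rewrite pnatr_eq0.
- move=> i j; rewrite !big_ord_recl big_ord0 /W.
  by case: i j => [[|[|//]] ?] [[|[|//]] ?] /=; ring.
move=> u v; rewrite !big_ord_recl big_ord0 /W /quad.
case: u v => [[|[|[|[|//]]]] ?] [[|[|[|[|//]]]] ?] //= _;
  rewrite ?(adj_sym G b a) ?(adj_sym G c) ?(adj_sym G d);
  rewrite ?Gab ?Gac ?Gad ?Gbc ?Gbd ?Gcd;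
  by [apply/eqP; ring | apply/eqP => eq0; clear -eq0; lra].
Qed.

(** * The shape of graphs of minimum semidefinite rank 2 *)

Definition nonisolated (T : finType) (G : sgraph T) : {set T} :=
  [set x | [exists y, G x y]].

Lemma nonisolatedP (T : finType) (G : sgraph T) x :
  reflect (exists y, G x y) (x \in nonisolated G).
Proof. by rewrite inE; apply: existsP. Qed.

(** What semidefinite rank 2 says about the graph; see common_nonneighbor_twin. *)
Definition nonneighbors_twin (T : finType) (G : sgraph T) : Prop :=
  forall x y z,
    x \in nonisolated G -> y \in nonisolated G -> z \in nonisolated G ->
    x != y -> z != y -> ~~ G x y -> ~~ G z y ->
  closed_nbhd G x = closed_nbhd G z.

(** If A x y were nonzero, the quadratic form at t e_x + e_y, which is
    2 t A x y + A y y, would be unbounded below in t. *)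
Lemma psd_diag0 (R : realType) n (A : 'M[R]_n) x y :
  psd A -> A x x = 0 -> A x y = 0.
Proof.
move=> [symA posA] Axx0; apply: contraTeq isT => nzAxy.
(* chosen so that the form takes the value -1 *)
pose t := - (A y y + 1) / (2 * A x y).
have Ayx : A y x = A x y by rewrite -[in LHS]symA mxE.
have entry i j : (delta_mx 0 i *m (A *m delta_mx j (0 : 'I_1))) (0 : 'I_1) 0 = A i j.
  by rewrite -rowE -colE !mxE.
have := posA (t *: delta_mx x 0 + delta_mx y 0).
rewrite [(_ + _)^T]raddfD /= [(_ *: _)^T]linearZ /= !trmx_delta -mulmxA.
rewrite mulmxDr mulmxDl -!scalemxAr !mulmxDr -!scalemxAl -!scalemxAr.
have addE (M N : 'M[R]_1) : (M + N) 0 0 = M 0 0 + N 0 0 by rewrite mxE.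
have scaleE (r : R) (M : 'M[R]_1) : (r *: M) 0 0 = r * M 0 0 by rewrite mxE.
rewrite !addE !scaleE !entry Axx0 Ayx.
rewrite (_ : _ + _ = - 1) ?oppr_ge0 ?ler10 //.
by rewrite /t; field; rewrite nzAxy.
Qed.

(** The 3 x 3 minor on rows z, x, y and columns w, x, y vanishes; three
    zero entries reduce it to a product. *)
Lemma rank2_minor (F : fieldType) n (A : 'M[F]_n) x y z w : \rank A = 2%N ->
    A x y = 0 -> A z y = 0 -> A y x = 0 ->
  A y y * (A z w * A x x - A z x * A x w) = 0.
Proof.
move=> rkA Axy Azy Ayx.
have [c1 [c2 [b1 [b2 defA]]]] : exists c1 c2 b1 b2 : 'I_n -> F,
    forall i j, A i j = c1 i * b1 j + c2 i * b2 j.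
  have := mulmx_base A; move: (col_base A) (row_base A); rewrite rkA => C B CB.
  exists (C ^~ 0), (C ^~ 1), (B 0), (B 1) => i j.
  rewrite -[in LHS]CB mxE big_ord_recl big_ord1.
  by congr (_ + C i _ * B _ j); apply: val_inj.
have detA : A z w * (A x x * A y y - A x y * A y x)
     - A z x * (A x w * A y y - A x y * A y w)
     + A z y * (A x w * A y x - A x x * A y w) = 0.
  by rewrite !defA; ring.
rewrite Axy Azy Ayx in detA.
by rewrite -[RHS]detA; ring.
Qed.

(** In the matrix of rank 2, rows x and z are proportional by rank2_minor, and the
    support of row v is the closed neighbourhood of v, since by positivity the
    diagonal entry of a non-isolated vertex is nonzero. *)
Lemma common_nonneighbor_twin (R : realType) n (G : sgraph 'I_n) :
  is_mrplus R G 2 -> nonneighbors_twin G.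
Proof.
move=> [[A [[symA GA] psdA] rkA] _] x y z Vx Vy Vz neq_xy neq_zy Gxy Gzy.
have sA i j : A i j = A j i by rewrite -[in LHS]symA mxE.
have diagA v : v \in nonisolated G -> A v v != 0.
  case/nonisolatedP=> w Gvw; have neq_vw : v != w.
    by apply: contraTneq Gvw => ->; rewrite adj_irr.
  by move: Gvw; rewrite -GA //; apply: contraNneq => /psd_diag0->.
have nbhdA v : v \in nonisolated G -> closed_nbhd G v = [set w | A v w != 0].
  move=> Vv; apply/setP=> w; rewrite !inE.
  have [->|neq_wv] /= := eqVneq w v; first by rewrite diagA.
  by rewrite GA // eq_sym.
have Axy : A x y = 0 by apply/eqP/negPn; rewrite GA.
have Azy : A z y = 0 by apply/eqP/negPn; rewrite GA.
have minor w : A z w * A x x = A z x * A x w.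
  have Ayx : A y x = 0 by rewrite sA.
  have/eqP := rank2_minor w rkA Axy Azy Ayx.
  by rewrite mulf_eq0 (negPf (diagA y Vy)) subr_eq0 => /eqP.
have nzAzx : A z x != 0.
  have := minor z; rewrite (sA x z) => Dzx.
  have : A z x * A z x != 0 by rewrite -Dzx mulf_neq0 ?diagA.
  by rewrite mulf_eq0 orbb.
rewrite !nbhdA //; apply/setP=> w; rewrite !inE.
have := minor w => /(congr1 (fun r => r == 0)); rewrite !mulf_eq0.
by rewrite (negPf nzAzx) (negPf (diagA x Vx)) orbF /= => ->.
Qed.

(** Otherwise the non-isolated vertices form a clique, and the Gram matrix of their
    indicator has rank at most 1, against the minimality of 2. *)
Lemma mrplus2_nonadjacent (R : realType) n (G : sgraph 'I_n) :
    is_mrplus R G 2 ->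
  exists x y, [/\ x \in nonisolated G, y \in nonisolated G, x != y & ~~ G x y].
Proof.
case=> _ min2; pose V := nonisolated G.
have [/existsP[x /existsP[y /and4P[Vx Vy xy Gxy]]]|clique] :=
  boolP [exists x, exists y, [&& x \in V, y \in V, x != y & ~~ G x y]].
  by exists x, y.
pose c : 'cV[R]_n := \col_i (i \in V)%:R.
suff /min2 : exists2 A : 'M[R]_n, in_S G A /\ psd A & \rank A = \rank (c *m c^T).
  by rewrite leqNgt ltnS (leq_trans (mxrankM_maxl _ _)) ?rank_leq_col.
have symA : (c *m c^T)^T = c *m c^T by rewrite trmx_mul trmxK.
exists (c *m c^T) => //; split; split=> //.
  move=> i j neq_ij; rewrite mxE big_ord1 !mxE -natrM pnatr_eq0 mulnb eqb0 negbK.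
  apply/idP/idP => [/andP[Vi Vj]|Gij].
    apply: contraNT clique => Gij.
    by apply/existsP; exists i; apply/existsP; exists j; apply/and4P.
  apply/andP; split; apply/nonisolatedP; first by exists j.
  by exists i; rewrite adj_sym.
move=> v; rewrite mulmxA -mulmxA.
have -> : c^T *m v = (v^T *m c)^T by rewrite trmx_mul trmxK.
by rewrite mxE big_ord1 [X in _ * X]mxE -expr2 sqr_ge0.
Qed.

(** * Twin classes *)

Section TwinClasses.
Variables (T : finType) (G : sgraph T).

Lemma closed_nbhdC x y : (y \in closed_nbhd G x) = (x \in closed_nbhd G y).
Proof. by rewrite !inE eq_sym adj_sym. Qed.

Lemma closed_nbhd_refl x : x \in closed_nbhd G x.
Proof. by rewrite inE eqxx. Qed.

Lemma mem_closed_nbhd x y : x != y -> (y \in closed_nbhd G x) = G x y.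
Proof. by rewrite inE eq_sym => /negPf->. Qed.

Lemma adj_nonisolated x y : G x y -> x \in nonisolated G.
Proof. by move=> Gxy; apply/nonisolatedP; exists y. Qed.

Lemma closed_nbhd_nonisolated x y :
  closed_nbhd G x = closed_nbhd G y -> x \in nonisolated G -> y \in nonisolated G.
Proof.
have [->//|neq_xy] := eqVneq x y; move=> eq_xy _.
have := closed_nbhd_refl y; rewrite -eq_xy mem_closed_nbhd // adj_sym.
exact: adj_nonisolated.
Qed.

Definition twin_rep x : T := odflt x [pick y | closed_nbhd G y == closed_nbhd G x].

Lemma twin_repP x : closed_nbhd G (twin_rep x) = closed_nbhd G x.
Proof. by rewrite /twin_rep; case: pickP => [y /eqP|] //=. Qed.

Lemma twin_rep_eq x y : closed_nbhd G x = closed_nbhd G y -> twin_rep x = twin_rep y.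
Proof.
move=> eq_xy; rewrite /twin_rep eq_xy; case: pickP => //= /(_ y).
by rewrite eqxx.
Qed.

Definition twin_reps : {set T} := twin_rep @: nonisolated G.

Lemma twin_reps_nonisolated x : x \in twin_reps -> x \in nonisolated G.
Proof.
case/imsetP=> y Vy ->; apply: closed_nbhd_nonisolated Vy.
by rewrite twin_repP.
Qed.

Lemma twin_reps_inj x y : x \in twin_reps -> y \in twin_reps ->
  closed_nbhd G x = closed_nbhd G y -> x = y.
Proof.
move=> /imsetP[x' _ ->] /imsetP[y' _ ->]; rewrite !twin_repP.
exact: twin_rep_eq.
Qed.

(** The unique non-neighbour of x among the representatives, and x itself if there
    is none (adj_partner, partnerK). *)
Definition partner x : T :=
  odflt x [pick y in twin_reps | (y != x) && ~~ G x y].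

Hypothesis nonadj_twin : nonneighbors_twin G.

Lemma partner_in x : x \in twin_reps -> partner x \in twin_reps.
Proof. by move=> Sx; rewrite /partner; case: pickP => // y /andP[]. Qed.

(** Two non-neighbours of x are twins, and representatives of one twin class
    coincide. *)
Lemma adj_partner x y : x \in twin_reps -> y \in twin_reps -> x != y ->
  G x y = (y != partner x).
Proof.
move=> Sx Sy neq_xy; rewrite /partner; case: pickP => [z|none] /=.
  case/and3P=> Sz neq_zx Gxz; have [->|neq_yz] := eqVneq y z; first by rewrite (negPf Gxz).
  apply: contra_neqT neq_yz => Gxy; apply: (twin_reps_inj Sy Sz).
  by apply: (@nonadj_twin y x z); rewrite ?twin_reps_nonisolated // 1?eq_sym // adj_sym.
rewrite eq_sym neq_xy; have /negbT := none y.
by rewrite Sy eq_sym neq_xy negbK.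
Qed.

Lemma partner_nonadj x : x \in twin_reps -> ~~ G x (partner x).
Proof.
move=> Sx; have [<-|neq_x] := eqVneq x (partner x); first by rewrite adj_irr.
by rewrite adj_partner ?partner_in ?eqxx.
Qed.

Lemma partnerK x : x \in twin_reps -> partner (partner x) = x.
Proof.
move=> Sx; have Spx := partner_in Sx.
have [eq_x|neq_x] := eqVneq x (partner x); first by rewrite -!eq_x.
apply/esym/eqP; apply: contraNT (partner_nonadj Sx) => neq.
by rewrite adj_sym adj_partner // eq_sym.
Qed.

Lemma fixed_closed_nbhd x : x \in twin_reps -> partner x = x ->
  closed_nbhd G x = nonisolated G.
Proof.
move=> Sx fix_x; apply/setP=> w; apply/idP/idP => [|Vw].
  have [<-|neq_xw] := eqVneq x w; first by rewrite twin_reps_nonisolated.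
  by rewrite mem_closed_nbhd // adj_sym => /adj_nonisolated.
have Sw : twin_rep w \in twin_reps by apply: imset_f.
rewrite closed_nbhdC -twin_repP closed_nbhdC.
have [<-|neq_xw] := eqVneq x (twin_rep w); first exact: closed_nbhd_refl.
by rewrite mem_closed_nbhd // adj_partner // fix_x eq_sym.
Qed.

Lemma fixed_unique x y : x \in twin_reps -> y \in twin_reps ->
  partner x = x -> partner y = y -> x = y.
Proof.
by move=> Sx Sy fx fy; apply: twin_reps_inj; rewrite ?fixed_closed_nbhd.
Qed.

End TwinClasses.

(** * Assembling the pieces *)

(** The partner map is an involution of the representatives.  Its 2-cycles, each
    listed through its smaller vertex, are the pairs, and its fixed points, of
    which there is at most one, are the vertices joined to all others. *)
Lemma cocktail_party_parametrization n (G : sgraph 'I_n) :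
    nonneighbors_twin G ->
  exists l h (f : 'I_l + 'I_l + 'I_h -> 'I_n),
    [/\ (h <= 1)%N, injective f, f @: [set: 'I_l + 'I_l + 'I_h] = twin_reps G
      & forall u v, u != v -> G (f u) (f v) = ~~ opposite u v].
Proof.
move=> nonadj_twin; pose S := twin_reps G; pose p := partner G.
have Sp x : x \in S -> p x \in S by apply: partner_in.
have pK x : x \in S -> p (p x) = x by apply: partnerK.
pose X := [set x in S | (x < p x)%N]; pose Z := [set x in S | p x == x].
pose f (u : 'I_#|X| + 'I_#|X| + 'I_#|Z|) : 'I_n :=
  match u with
  | inl (inl i) => enum_val i
  | inl (inr i) => p (enum_val i)
  | inr k => enum_val k
  end.
have inX (i : 'I_#|X|) : enum_val i \in S /\ (enum_val i < p (enum_val i))%N.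
  by have := enum_valP i; rewrite inE => /andP.
have inZ (k : 'I_#|Z|) : enum_val k \in S /\ p (enum_val k) = enum_val k.
  by have := enum_valP k; rewrite inE => /andP[Sk /eqP].
(* the partner map read on the index set *)
pose opp (u : 'I_#|X| + 'I_#|X| + 'I_#|Z|) : 'I_#|X| + 'I_#|X| + 'I_#|Z| :=
  match u with
  | inl (inl i) => inl (inr i)
  | inl (inr i) => inl (inl i)
  | inr k => inr k
  end.
have f_opp u : p (f u) = f (opp u).
  case: u => [[i|i]|k] //=; first by rewrite pK //; case: (inX i).
  by case: (inZ k).
have Sf u : f u \in S.
  case: u => [[i|i]|k] /=; first by case: (inX i).
    by apply: Sp; case: (inX i).
  by case: (inZ k).
have injf : injective f.
  move=> [[i|i]|k] [[j|j]|k'] /= eq_f.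
  - by rewrite (enum_val_inj eq_f).
  - have [_] := inX i; have [Sj lt_j] := inX j; rewrite eq_f pK // => lt_i.
    by have := ltn_trans lt_i lt_j; rewrite ltnn.
  - by have [_] := inX i; have [_ fix_k] := inZ k'; rewrite eq_f fix_k ltnn.
  - have [_] := inX j; have [Si lt_i] := inX i; rewrite -eq_f pK // => lt_j.
    by have := ltn_trans lt_i lt_j; rewrite ltnn.
  - have [Si _] := inX i; have [Sj _] := inX j.
    by have := congr1 p eq_f; rewrite !pK // => /enum_val_inj->.
  - have [Si] := inX i; have [_ fix_k] := inZ k'.
    by move: fix_k; rewrite -eq_f pK // => <-; rewrite ltnn.
  - by have [_] := inX j; have [_ fix_k] := inZ k; rewrite -eq_f fix_k ltnn.
  - have [Sj] := inX j; have [_ fix_k] := inZ k.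
    by move: fix_k; rewrite eq_f pK // => <-; rewrite ltnn.
  - by rewrite (enum_val_inj eq_f).
exists #|X|, #|Z|, f; split=> //.
- rewrite leqNgt; apply/negP=> /card_gt1P[x [y []]].
  rewrite !inE => /andP[Sx /eqP fx] /andP[Sy /eqP fy] /eqP[].
  exact: (fixed_unique nonadj_twin).
- apply/setP=> x; apply/imsetP/idP => [[u _ ->] //|Sx].
  have [lt_x|lt_x|eq_x] := ltngtP x (p x).
  + have Xx : x \in X by rewrite inE Sx.
    by exists (inl (inl (enum_rank_in Xx x))); rewrite ?in_setT //= enum_rankK_in.
  + have Xx : p x \in X by rewrite inE Sp // pK.
    by exists (inl (inr (enum_rank_in Xx (p x)))); rewrite ?in_setT //= enum_rankK_in // pK.
  + have Zx : x \in Z by rewrite inE Sx; apply/eqP/val_inj.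
    by exists (inr (enum_rank_in Zx x)); rewrite ?in_setT //= enum_rankK_in.
move=> u v neq_uv; rewrite (adj_partner nonadj_twin) ?Sf ?(inj_eq injf) //.
rewrite -/p f_opp (inj_eq injf).
by case: u v neq_uv => [[i|i]|k] [[j|j]|k'] //=; rewrite eq_sym // => /negPf->.
Qed.

(** In the excluded family, adjacency of distinct vertices only depends on their
    classes: 0 for the vertex K_{1,0}, 1 and 2 for the two sides of K_{p,q} (two
    cliques after complementation), 3 for K_r (isolated vertices after
    complementation). *)
Definition class_adj (i j : nat) : bool :=
  [&& i != 3, j != 3, (i, j) != (1, 2) & (i, j) != (2, 1)]%N.

(** Vertices of one class are numbered by an enumeration of that class; this is a
    bijection because the classes on both sides have equal sizes. *)
Lemma excluded_shape_iso n (G : sgraph 'I_n) (c : 'I_n -> nat) :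
    (forall x, c x < 4)%N -> #|[set x | c x == 0%N]| = 1%N ->
    (forall x y, x != y -> G x y = class_adj (c x) (c y)) ->
  graph_iso G
    (compl (join (disj_union (complete_bipartite 1 0)
       (complete_bipartite #|[set x | c x == 1%N]| #|[set x | c x == 2%N]|))
                 (complete #|[set x | c x == 3%N]|))).
Proof.
move=> c_lt4 /eqP/cards1P[u0 def_u0] Gc.
set A := [set x | c x == 1%N]; set B := [set x | c x == 2%N].
set I := [set x | c x == 3%N].
set H := compl _.
pose d (u : ('I_1 + 'I_0) + ('I_#|A| + 'I_#|B|) + 'I_#|I|) : nat :=
  match u with
  | inl (inl _) => 0 | inl (inr (inl _)) => 1 | inl (inr (inr _)) => 2
  | inr _ => 3
  end%N.
pose g (u : ('I_1 + 'I_0) + ('I_#|A| + 'I_#|B|) + 'I_#|I|) : 'I_n :=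
  match u with
  | inl (inl _) => u0
  | inl (inr (inl i)) => enum_val i
  | inl (inr (inr i)) => enum_val i
  | inr i => enum_val i
  end.
have cg u : c (g u) = d u.
  case: u => [[_|[i|i]]|i] /=.
  - by apply/eqP; have := set11 u0; rewrite -def_u0 inE.
  - by apply/eqP; have := enum_valP i; rewrite inE.
  - by apply/eqP; have := enum_valP i; rewrite inE.
  - by apply/eqP; have := enum_valP i; rewrite inE.
have injg : injective g.
  move=> u v eq_g; have : d u = d v by rewrite -!cg eq_g.
  case: u v eq_g => [[[i|[//]]|[i|i]]|i] [[[j|[//]]|[j|j]]|j] //=.
  - by rewrite (ord1 i) (ord1 j).
  - by move/enum_val_inj->.
  - by move/enum_val_inj->.
  - by move/enum_val_inj->.
have surjg x : exists u, g u == x.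
  have := c_lt4 x; case cx: (c x) => [|[|[|[|//]]]] _.
  - exists (inl (inl (inl 0))); rewrite /= eq_sym.
    by have : x \in [set u0]; [rewrite -def_u0 inE cx|rewrite inE].
  - have Ax : x \in A by rewrite inE cx.
    by exists (inl (inr (inl (enum_rank_in Ax x)))); rewrite /= enum_rankK_in.
  - have Bx : x \in B by rewrite inE cx.
    by exists (inl (inr (inr (enum_rank_in Bx x)))); rewrite /= enum_rankK_in.
  - have Ix : x \in I by rewrite inE cx.
    by exists (inr (enum_rank_in Ix x)); rewrite /= enum_rankK_in.
pose f x := xchoose (surjg x).
have fK x : g (f x) = x by apply/eqP/(xchooseP (surjg x)).
have gK u : f (g u) = u by apply: injg; rewrite fK.
have Hd u v : u != v -> H u v = class_adj (d u) (d v).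
  case: u v => [[[i|[//]]|[i|i]]|i] [[[j|[//]]|[j|j]]|j] //= neq_uv;
    rewrite /compl_rel /= ?andbT.
  - by rewrite neq_uv.
  - by rewrite neq_uv.
  - by rewrite neq_uv.
  - by rewrite andbN.
exists f; split; first by exists g.
move=> x y; have [->|neq_xy] := eqVneq x y; first by rewrite !adj_irr.
rewrite Hd; last by apply: contra_neq neq_xy => eq_f; rewrite -(fK x) eq_f.
by rewrite -!cg !fK Gc.
Qed.

(** When the representatives contain l > 1 non-adjacent pairs, they serve as S0.
    For l = 1 they induce two isolated vertices or a path on three vertices, which
    are too small, so S0 also takes in twins to reach four vertices; the excluded
    graphs are those where the middle of the path has no twin to add. *)
Lemma base_projection (R : realType) n (G : sgraph 'I_n) :
    nonneighbors_twin G ->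
    (exists x y,
       [/\ x \in nonisolated G, y \in nonisolated G, x != y & ~~ G x y]) ->
    ~ (exists p q r : nat,
      (0 < p)%N /\ (0 < q)%N /\
      graph_iso G
        (compl (join (disj_union (complete_bipartite 1 0) (complete_bipartite p q))
                     (complete r)))) ->
  exists (S0 : {set 'I_n}) k (F : 'M[R]_n),
    [/\ projection_on G S0 k F, (2 * k <= #|S0| <= 2 * k + 1)%N, (1 < k)%N &
      forall y, y \notin S0 -> (forall z, ~~ G y z) \/
       exists x z, [/\ x \in S0, z \in S0, G x z
                     & closed_nbhd G x = closed_nbhd G y]].
Proof.
move=> nonadj_twin [x0 [y0 [Vx0 Vy0 neq0 Gxy0]]] not_excluded.
have [l [h [f [h_le1 injf imf Gf]]]] := cocktail_party_parametrization nonadj_twin.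
have ext (S0 : {set 'I_n}) :
    (forall s, s \in twin_reps G -> exists x z, [/\ x \in S0, z \in S0, G x z
        & closed_nbhd G x = closed_nbhd G s]) ->
    forall y, y \notin S0 -> (forall z, ~~ G y z) \/
       exists x z, [/\ x \in S0, z \in S0, G x z
                     & closed_nbhd G x = closed_nbhd G y].
  move=> repS0 y _; have [Vy|Vy] := boolP (y \in nonisolated G).
    right; have [|x [z [S0x S0z Gxz eq_xy]]] := repS0 (twin_rep G y).
      exact: imset_f.
    by exists x, z; rewrite eq_xy twin_repP.
  by left=> z; apply: contra Vy => /adj_nonisolated.
have cardS : #|twin_reps G| = (l + l + h)%N.
  by rewrite -imf card_imset // cardsT !card_sum !card_ord.
have Sf u : f u \in twin_reps G by rewrite -imf imset_f.
have Srep x : x \in nonisolated G -> twin_rep G x \in twin_reps G.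
  exact: imset_f.
have [l_gt1|l_le1] := ltnP 1 l.
  have [F pF] := cocktail_party_projection R l_gt1 h_le1 injf Gf.
  exists (twin_reps G), l, F; rewrite -imf; split=> //; rewrite imf.
    by rewrite cardS; lia.
  apply: ext => s Ss; exists s.
  have /subsetPn[z Sz] : ~~ (twin_reps G \subset [set s; partner G s]).
    apply/negP=> /subset_leq_card; rewrite cardS cards2.
    by case: (s != _) => /=; lia.
  rewrite !inE negb_or => /andP[zs zp]; exists z; split=> //.
  by rewrite (adj_partner nonadj_twin) // eq_sym.
have l_gt0 : (0 < l)%N.
  have : twin_rep G y0 \notin closed_nbhd G (twin_rep G x0).
    rewrite twin_repP closed_nbhdC twin_repP closed_nbhdC.
    by rewrite mem_closed_nbhd.
  move: (Srep _ Vx0) (Srep _ Vy0); rewrite -imf => /imsetP[u _ ->] /imsetP[v _ ->].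
  have [->|neq_uv] := eqVneq u v; first by rewrite closed_nbhd_refl.
  rewrite mem_closed_nbhd ?(inj_eq injf) // Gf // negbK.
  by case: u {neq_uv} => [[i|i]|k] //= _; apply: leq_ltn_trans (ltn_ord i).
have l1 : l = 1%N by lia.
subst l; clear l_le1 l_gt0.
pose a := f (inl (inl 0)); pose b := f (inl (inr 0)).
have Gab : ~~ G a b by rewrite Gf // negbK /= eqxx.
have neq_ab : a != b by rewrite (inj_eq injf).
have Va : a \in nonisolated G by apply/twin_reps_nonisolated/Sf.
have Vb : b \in nonisolated G by apply/twin_reps_nonisolated/Sf.
have sep x y : closed_nbhd G x = closed_nbhd G a ->
    closed_nbhd G y = closed_nbhd G b -> y \notin closed_nbhd G x.
  by move=> -> eq_y; rewrite closed_nbhdC eq_y closed_nbhdC mem_closed_nbhd.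
have nonadj x y : y \notin closed_nbhd G x -> x != y /\ ~~ G x y.
  by rewrite inE negb_or eq_sym => /andP.
have classes x : x \in nonisolated G ->
    [\/ closed_nbhd G x = closed_nbhd G a, closed_nbhd G x = closed_nbhd G b
      | exists k, closed_nbhd G x = closed_nbhd G (f (inr k))].
  move/Srep; rewrite -(twin_repP G x) -imf => /imsetP[[[i|i]|k] _ ->].
  - by constructor 1; rewrite (ord1 i).
  - by constructor 2; rewrite (ord1 i).
  - by constructor 3; exists k.
case: (posnP h) => [h0|h_gt0].
  subst h.
  (* every class is that of a or of b, and vertices of different classes are not
     adjacent, so a and b have their neighbours in their own class *)
  have nbr x : x \in nonisolated G -> exists2 x', G x x' &
      closed_nbhd G x' = closed_nbhd G x.
    move=> Vx; have /nonisolatedP[x' Gxx'] := Vx; exists x' => //.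
    have Vx' : x' \in nonisolated G.
      by apply: (@adj_nonisolated _ _ _ x); rewrite adj_sym.
    have [x_a|x_b|[[//]]] := classes x Vx;
      have [x'_a|x'_b|[[//]]] := classes x' Vx'.
    - by rewrite x_a.
    - by have /nonadj[_] := sep _ _ x_a x'_b; rewrite Gxx'.
    - by have /nonadj[_] := sep _ _ x'_a x_b; rewrite adj_sym Gxx'.
    - by rewrite x_b.
  have [a' Gaa' eq_a] := nbr a Va; have [b' Gbb' eq_b] := nbr b Vb.
  have [neq_ab' Gab'] := nonadj _ _ (sep a b' erefl eq_b).
  have [neq_a'b Ga'b] := nonadj _ _ (sep a' b eq_a erefl).
  have [neq_a'b' Ga'b'] := nonadj _ _ (sep a' b' eq_a eq_b).
  have neq_aa' : a != a' by apply: contraTneq Gaa' => <-; rewrite adj_irr.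
  have neq_bb' : b != b' by apply: contraTneq Gbb' => <-; rewrite adj_irr.
  have uniq_s : uniq [:: a; a'; b; b'].
    by rewrite /= !inE !negb_or neq_aa' neq_ab neq_ab' neq_a'b neq_a'b' neq_bb'.
  have [F pF] := two_edges_projection R uniq_s Gaa' Gbb' (And4 Gab Gab' Ga'b Ga'b').
  exists [set x in [:: a; a'; b; b']], 2%N, F; split=> //.
    by rewrite cardsE (card_uniqP uniq_s).
  apply: ext => s; rewrite -imf => /imsetP[[[i|i]|[//]] _ ->]; rewrite (ord1 i).
    by exists a, a'; rewrite !inE !eqxx ?orbT.
  by exists b, b'; rewrite !inE !eqxx ?orbT.
have h1 : h = 1%N by lia.
subst h; pose u := f (inr 0).
have Gau : G a u by rewrite Gf.
have Gbu : G b u by rewrite Gf.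
have nbhd_u : closed_nbhd G u = nonisolated G.
  apply/setP=> w; apply/idP/idP=> [|Vw].
    have [<-|neq_uw] := eqVneq u w; first by rewrite twin_reps_nonisolated ?Sf.
    by rewrite mem_closed_nbhd // adj_sym => /adj_nonisolated.
  rewrite closed_nbhdC -twin_repP closed_nbhdC.
  have := Srep w Vw; rewrite -imf => /imsetP[v _ ->].
  have [<-|neq_v] := eqVneq (inr 0) v; first exact: closed_nbhd_refl.
  by rewrite mem_closed_nbhd ?(inj_eq injf) // Gf.
have [/existsP[u' /andP[neq_uu' /eqP eq_u]]|no_twin] :=
    boolP [exists u', (u != u') && (closed_nbhd G u' == closed_nbhd G u)].
  have Guu' : G u u' by rewrite -mem_closed_nbhd // -eq_u closed_nbhd_refl.
  (* N[u'] = N[u] contains all non-isolated vertices *)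
  have far x : x \in nonisolated G -> closed_nbhd G x != nonisolated G ->
      x != u' /\ G x u'.
    move=> Vx; rewrite -nbhd_u -eq_u => neq_x.
    have neq_xu' : x != u' by apply: contraNneq neq_x => ->.
    split=> //; rewrite adj_sym -mem_closed_nbhd 1?eq_sym //.
    by rewrite eq_u nbhd_u.
  have nbhd_neq x y : y \in nonisolated G -> x != y -> ~~ G x y ->
      closed_nbhd G x != nonisolated G.
    move=> Vy neq_xy Gxy; apply: contraNneq Gxy => eq_x.
    by rewrite -mem_closed_nbhd // eq_x.
  have [neq_au' Gau'] := far a Va (nbhd_neq a b Vb neq_ab Gab).
  have [neq_bu' Gbu'] : b != u' /\ G b u'.
    by apply: far => //; apply: (nbhd_neq b a) => //; rewrite 1?eq_sym // adj_sym.
  have uniq_s : uniq [:: a; b; u; u'].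
    by rewrite /= !inE !negb_or neq_ab neq_au' neq_bu' neq_uu' !(inj_eq injf).
  have [F pF] := diamond_projection R uniq_s Gab (And5 Gau Gau' Gbu Gbu' Guu').
  exists [set x in [:: a; b; u; u']], 2%N, F; split=> //.
    by rewrite cardsE (card_uniqP uniq_s).
  apply: ext => s; rewrite -imf => /imsetP[[[i|i]|i] _ ->]; rewrite (ord1 i).
  - by exists a, u; rewrite !inE !eqxx ?orbT.
  - by exists b, u; rewrite !inE !eqxx ?orbT.
  - by exists u, u'; rewrite !inE !eqxx ?orbT.
case: not_excluded.
pose c x : nat := if x == u then 0%N else
  if closed_nbhd G x == closed_nbhd G a then 1%N else
  if closed_nbhd G x == closed_nbhd G b then 2%N else 3%N.
exists #|[set x | c x == 1%N]|, #|[set x | c x == 2%N]|, #|[set x | c x == 3%N]|.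
have neq_au : a != u by rewrite (inj_eq injf).
have neq_bu : b != u by rewrite (inj_eq injf).
have neq_nbhd : closed_nbhd G b != closed_nbhd G a.
  by apply/eqP=> /sep/(_ erefl); rewrite closed_nbhd_refl.
have c_u x : c x = 0%N -> x = u.
  by rewrite /c; case: eqP => // _; do 2?case: ifP.
have c_a x : c x = 1%N -> closed_nbhd G x = closed_nbhd G a.
  by rewrite /c; do 3?case: eqP.
have c_b x : c x = 2%N -> closed_nbhd G x = closed_nbhd G b.
  by rewrite /c; do 3?case: eqP.
have c_iso x : c x = 3%N -> x \notin nonisolated G.
  rewrite /c; do 3?case: eqP => // ?; move=> _; apply/negP=> /classes[//|//|[k]].
  rewrite (ord1 k) => eq_x; case/existsP: no_twin; exists x.
  by rewrite eq_sym eq_x eqxx andbT; apply/eqP.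
split; [|split].
- by apply/card_gt0P; exists a; rewrite inE /c (negPf neq_au) eqxx.
- by apply/card_gt0P; exists b; rewrite inE /c (negPf neq_bu) (negPf neq_nbhd) eqxx.
apply: excluded_shape_iso => [x||x y neq_xy].
- by rewrite /c; do 3?case: ifP.
- rewrite (_ : [set x | _] = [set u]) ?cards1 //; apply/setP=> x; rewrite !inE.
  by apply/eqP/eqP=> [/c_u//|->]; rewrite /c eqxx.
have c_lt4 z : (c z < 4)%N by rewrite /c; do 3?case: ifP.
have iso_l z w : c z = 3%N -> G z w = false.
  by move/c_iso=> Vz; apply/negP=> /adj_nonisolated; apply/negP.
have dom z w : z != w -> c z = 0%N -> c w != 3%N -> G z w.
  move=> neq_zw /c_u Dz cw; rewrite Dz in neq_zw *.
  rewrite -mem_closed_nbhd // nbhd_u; apply: contraNT cw => Vw.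
  have wV v : v \in nonisolated G -> closed_nbhd G w != closed_nbhd G v.
    by move=> Vv; apply: contraNneq Vw => /esym/closed_nbhd_nonisolated/(_ Vv).
  by rewrite /c (eq_sym w) (negPf neq_zw) (negPf (wV a Va)) (negPf (wV b Vb)).
have same z w : z != w -> closed_nbhd G z = closed_nbhd G w -> G z w.
  by move=> neq_zw eq_zw; rewrite -mem_closed_nbhd // eq_zw closed_nbhd_refl.
have apart z w : c z = 1%N -> c w = 2%N -> G z w = false.
  by move=> /c_a za /c_b wb; have /nonadj[_ /negPf] := sep z w za wb.
case cx: (c x) (c_lt4 x) => [|[|[|[|//]]]] _;
  case cy: (c y) (c_lt4 y) => [|[|[|[|//]]]] _;
  rewrite /class_adj /=.
- by apply: dom; rewrite ?cx ?cy.
- by apply: dom; rewrite ?cx ?cy.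
- by apply: dom; rewrite ?cx ?cy.
- by rewrite adj_sym iso_l.
- by rewrite adj_sym; apply: dom; rewrite ?cx ?cy // eq_sym.
- by apply: same => //; rewrite (c_a x cx) (c_a y cy).
- by rewrite apart.
- by rewrite adj_sym iso_l.
- by rewrite adj_sym; apply: dom; rewrite ?cx ?cy // eq_sym.
- by rewrite adj_sym apart.
- by apply: same => //; rewrite (c_b x cx) (c_b y cy).
- by rewrite adj_sym iso_l.
all: by rewrite iso_l.
Qed.

Theorem corollary4p1 (R : realType) (n : nat) (G : sgraph 'I_n)
  (hmr : is_mrplus R G 2)
  (hG : ~ exists p q r : nat,
      (0 < p)%N /\ (0 < q)%N /\
      graph_iso G
        (compl (join (disj_union (complete_bipartite 1 0) (complete_bipartite p q))
                     (complete r)))) :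
  is_Mm R G n./2.
Proof.
have twins := common_nonneighbor_twin hmr.
have nonadj := mrplus2_nonadjacent hmr.
have [S0 [k [F0 [pF0 /andP[le_k le_S0] k_gt1 extS0]]]] :=
  base_projection R twins nonadj hG.
have le_S0n : (#|S0| <= n)%N by rewrite -[X in (_ <= X)%N]card_ord max_card.
have [|F pF] := projection_on_extend pF0 extS0 (j := n./2 - k); first by lia.
have [symF idF trF _ GF] := pF.
rewrite (_ : (k + (n./2 - k))%N = n./2) in trF; last by lia.
split.
  exists F; last by apply: projection_Mm_mx => //; lia.
  by split=> // i j neq_ij; rewrite GF.
case: nonadj => x [_ [/nonisolatedP[y Gxy] _ _ _]] m [A SA mA].
exact: Mm_upper_bound Gxy SA mA.
Qed.
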